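(* Let $p,q\geq 1$. Suppose that $(M_j,d_j)$ is a proper geodesic metric space containing an almost geodesic sequence for $j=1,\ldots,p$, and that, for $j=1,\ldots,q$, $(N_j,\rho_j)$ is a proper geodesic metric space such that all its horofunctions are Busemann points, and $\delta(h_j,h_j')=\infty$ for all Busemann points $h_j\neq h_j'$ of $(N_j,\rho_j)$. If $p>q$, then there exists no isometric embedding of $(\prod_{j=1}^p M_j,d_\infty)$ into $(\prod_{j=1}^q N_j,d_\infty)$.
   Context: A metric space is proper if all closed balls are compact, and geodesic if any two points $x,y$ are joined by a path $\gamma\colon[a,b]\to M$ with $\gamma(a)=x$, $\gamma(b)=y$ and $d(\gamma(s),\gamma(t))=|s-t|$ for all $s,t$. Given metric spaces $(M_j,d_j)$, $j=1,\ldots,p$, the product carries the sup-metric $d_\infty(x,y)=\max_j d_j(x_j,y_j)$ (and similarly for the $(N_j,\rho_j)$). Let $(M,d)$ be a metric space with fixed basepoint $b\in M$. For $y\in M$ put $h_y(z)=d(z,y)-d(b,y)$. The metric compactification $\overline{M}^h$ is the closure of $\{h_y\colon y\in M\}$ in $\mathbb{R}^M$ with the topology of pointwise convergence. The elements of $\partial\overline{M}^h=\overline{M}^h\setminus\{h_y\colon y\in M\}$ are called horofunctions. A sequence $(y^n)_{n\geq 0}$ in $M$ is an almost geodesic sequence if $d(y^n,y^0)\to\infty$ and for each $\varepsilon>0$ there exists $N\geq 0$ such that $d(y^m,y^k)+d(y^k,y^0)-d(y^m,y^0)<\varepsilon$ for all $m\geq k\geq N$. In a proper geodesic metric space, a horofunction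 $h$ is a Busemann point if there is an almost geodesic sequence $(y^n)$ with $h(x)=\lim_{n} d(x,y^n)-d(b,y^n)$ for all $x\in M$. For Busemann points $h_1,h_2$ the detour cost is $H(h_1,h_2)=\inf_{(z^n)}\liminf_n \big(d(b,z^n)+h_2(z^n)\big)\in[0,\infty]$, where the infimum is over all sequences $(z^n)$ in $M$ with $h_{z^n}\to h_1$ pointwise. The detour distance is $\delta(h_1,h_2)=H(h_1,h_2)+H(h_2,h_1)$; it is independent of the basepoint. An isometric embedding is a distance-preserving map, not necessarily onto. *)

(* Defs.v *)
From HB Require Import structures.
From mathcomp Require Import all_boot all_order all_algebra.
From mathcomp Require Import all_classical all_reals all_analysis.

Set Implicit Arguments.
Unset Strict Implicit.
Unset Printing Implicit Defensive.

Import Order.TTheory GRing.Theory Num.Theory.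
Import numFieldNormedType.Exports.

Local Open Scope classical_set_scope.
Local Open Scope ring_scope.

(* The closed ball is spelled out because the library's closed_ball is the
   closure of the open ball, which may be smaller in a general metric space. *)
Definition proper_metric (R : realType) (M : metricType R) : Prop :=
  forall (x : M) (r : R), compact [set y : M | mdist x y <= r].

(* Only the restriction of g to [a, b] matters; as a <= b, every path defined
   on [a, b] extends to a total function. *)
Definition geodesic_metric (R : realType) (M : metricType R) : Prop :=
  forall x y : M, exists (a b : R) (g : R -> M),
    [/\ a <= b, g a = x, g b = y &
        forall s t : R, a <= s <= b -> a <= t <= b ->
          mdist (g s) (g t) = `|s - t|].

Definition sup_dist (R : realType) (n : nat) (M : 'I_n -> metricType R)
    (x y : forall j : 'I_n, M j) : R :=
  \big[Num.max/0]_(j < n) mdist (x j) (y j).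

Definition isometric_embedding (R : realType) (X Y : Type)
    (dX : X -> X -> R) (dY : Y -> Y -> R) (f : X -> Y) : Prop :=
  forall x x' : X, dY (f x) (f x') = dX x x'.

Definition internal_functional (R : realType) (M : metricType R) (b y : M) :
    {ptws M -> R} :=
  fun z : M => mdist z y - mdist b y.

Definition metric_compactification (R : realType) (M : metricType R) (b : M) :
    set {ptws M -> R} :=
  closure (range (internal_functional b)).

Definition horofunctions (R : realType) (M : metricType R) (b : M) :
    set {ptws M -> R} :=
  metric_compactification b `\` range (internal_functional b).

Definition almost_geodesic (R : realType) (M : metricType R) (y : nat -> M) :
    Prop :=
  mdist (y n) (y 0%N) @[n --> \oo] --> +oo /\
  forall e : R, 0 < e -> exists N : nat, forall m k : nat,
    (N <= k)%N -> (k <= m)%N ->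
    mdist (y m) (y k) + mdist (y k) (y 0%N) - mdist (y m) (y 0%N) < e.

Definition busemann_points (R : realType) (M : metricType R) (b : M) :
    set {ptws M -> R} :=
  [set h | horofunctions b h /\
    exists y : nat -> M, almost_geodesic y /\
      forall x : M, mdist x (y n) - mdist b (y n) @[n --> \oo] --> h x].

(* The infimum is taken in the extended reals, so it is +oo when no sequence
   converges to h1. *)
Definition detour_cost (R : realType) (M : metricType R) (b : M)
    (h1 h2 : {ptws M -> R}) : \bar R :=
  ereal_inf [set limn_einf (fun n => (mdist b (z n) + h2 (z n))%:E) |
    z in [set z : nat -> M |
      {ptws, internal_functional b (z n) @[n --> \oo] --> h1}]].

(* Both summands are nonnegative on Busemann points, so no indeterminate sum
   of infinities arises. *)
Definition detour_dist (R : realType) (M : metricType R) (b : M)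
    (h1 h2 : {ptws M -> R}) : \bar R :=
  (detour_cost b h1 h2 + detour_cost b h2 h1)%E.

(* Main.v *)
(* Each [M j] contains an isometric copy [u j] of the natural numbers, so every
   vector [x] in {0,1}^p gives a sequence [n |-> (u j (n + x j))_j] in the
   product, and the distance from time [n] along [x] to time [m > n] along [x']
   is [m - n + c x x'] with [c x x' = max_j (x' j - x j)]. Map these sequences by
   the isometric embedding and take limits along one ultrafilter: coordinate [i]
   gives a limit function [h x i] and, when [n - d(b i, z n)] stays bounded, its
   limit [a x i]. The set [J] of coordinates where this happens is the same for
   all [x]; there the [h x i] are horofunctions at pairwise finite detour
   distance, hence do not depend on [x]. It follows that
   [max_(i in J) (a x i - a x' i) = c x x'], so [a] embeds the 2^p vertices of
   the cube as points of R^J at pairwise sup-distance 1, and at most 2^q such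
   points exist. *)

Require Import Defs.
From mathcomp Require Import all_boot all_order all_algebra.
From mathcomp Require Import all_classical all_reals all_analysis.
From mathcomp Require Import lra.

Import Order.TTheory GRing.Theory Num.Theory.
Import numFieldNormedType.Exports.

Set Implicit Arguments.
Unset Strict Implicit.

Local Open Scope classical_set_scope.
Local Open Scope ring_scope.

(** * Limits along ultrafilters *)

Lemma ultra_fmap (S T : Type) (f : S -> T) (U : set_system S) :
  UltraFilter U -> UltraFilter (f @ U).
Proof.
move=> FU; split=> [|G FG UG]; first exact: fmap_proper_filter.
apply/seteqP; split=> // A GA.
have [//|UA] := in_ultra_setVsetC (f @^-1` A) FU.
have : G (~` A) by exact: UG.
by move=> /(filterI GA)/filter_ex[x []].
Qed.

(** Otherwise [U] would contain the complement of every [P i], hence, [I] being finite, the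
    intersection of these complements. *)
Lemma ultra_near_ex (S : Type) (U : set_system S) (I : finType)
    (P : I -> S -> Prop) :
  UltraFilter U -> (\forall t \near U, exists i, P i t) ->
  exists i, \forall t \near U, P i t.
Proof.
move=> FU UP; apply: contrapT => /forallNP nP.
have /filter_forall : forall i, \forall t \near U, ~ P i t.
  by move=> i; have [/nP|] := in_ultra_setVsetC (P i) FU.
by move=> /(filterI UP)/filter_ex[t [[i Pit] /(_ i)]].
Qed.

Lemma ultra_compact_cvg (S : Type) (T : topologicalType) (U : set_system S)
    (f : S -> T) (K : set T) :
  UltraFilter U -> compact K -> (\forall t \near U, K (f t)) ->
  exists2 l, K l & f t @[t --> U] --> l.
Proof.
move=> FU; rewrite compact_ultra => /(_ (f @ U)) cK UK.
by have [l []] := cK (ultra_fmap f FU) UK; exists l.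
Qed.

Lemma ultra_bounded_cvg (R : realType) (S : Type) (U : set_system S)
    (f : S -> R) (c d : R) :
  UltraFilter U -> (\forall t \near U, c <= f t <= d) -> cvg (f t @[t --> U]).
Proof.
move=> FU Uf; have [|l _ fl] := ultra_compact_cvg (f := f) FU (@segment_compact R c d).
  by apply: filterS Uf => t; rewrite /= in_itv.
by apply/cvg_ex; exists l.
Qed.

Lemma cvg_mdist (R : realType) (M : metricType R) (S : Type)
    (U : set_system S) {FU : Filter U} (f g : S -> M) (x y : M) :
  f t @[t --> U] --> x -> g t @[t --> U] --> y ->
  mdist (f t) (g t) @[t --> U] --> mdist x y.
Proof.
move=> /metricType_numDomainType.cvgrPdist_lt fx.
move=> /metricType_numDomainType.cvgrPdist_lt gy.
apply/cvgrPdist_lt => e e0; near=> t.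
have xf : mdist x (f t) < e / 2 by near: t; apply: fx; rewrite divr_gt0.
have yg : mdist y (g t) < e / 2 by near: t; apply: gy; rewrite divr_gt0.
have := metric_triangle x (f t) y; have := metric_triangle (f t) (g t) y.
have := metric_triangle (f t) x (g t); have := metric_triangle x y (g t).
rewrite (metric_sym (g t) y) (metric_sym (f t) x) => *.
rewrite ltr_norml; apply/andP; split; lra.
Unshelve. all: by end_near. Qed.

(** * Geodesic rays in proper geodesic spaces *)

Lemma geodesic_from0 (R : realType) (M : metricType R) (x y : M) :
  geodesic_metric M -> exists g : R -> M,
    [/\ g 0 = x, g (mdist x y) = y &
        forall s t, 0 <= s <= mdist x y -> 0 <= t <= mdist x y ->
          mdist (g s) (g t) = `|s - t|].
Proof.
move=> /(_ x y)[a [b [g [ab gax gby gE]]]].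
have dE : mdist x y = b - a.
  by rewrite -gax -gby gE ?lexx ?ab// distrC ger0_norm// subr_ge0.
exists (fun t => g (a + t)); split; rewrite ?addr0// ?dE; first by rewrite addrC subrK.
move=> s t sab tab; rewrite gE; first by congr `| _ |; lra.
- by apply/andP; split; lra.
- by apply/andP; split; lra.
Qed.

(** The point at distance [k] along a geodesic from [y 0] to [y n] lies in a compact ball; [u k] is
    its limit as [n] runs along an ultrafilter. *)
Lemma proper_geodesic_ray (R : realType) (M : metricType R) (y : nat -> M) :
  proper_metric M -> geodesic_metric M ->
  mdist (y n) (y 0%N) @[n --> \oo] --> +oo ->
  exists u : nat -> M, forall m n, mdist (u m) (u n) = `|n%:R - m%:R|.
Proof.
move=> Mp Mg yoo; have [U [FU ooU]] := ultraFilterLemma eventually_filter.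
have {yoo} yU (r : R) : \forall n \near U, r <= mdist (y 0%N) (y n).
  apply: ooU; move/cvgryPge : yoo => /(_ r); apply: filterS => n.
  by rewrite metric_sym.
have /choice[g gP] n := geodesic_from0 (y 0%N) (y n) Mg.
have gU (k : nat) : exists v : M, g n k%:R @[n --> U] --> v.
  have [|v _ ?] := @ultra_compact_cvg _ _ U (fun n => g n k%:R) _ FU (Mp (y 0%N) k%:R);
    last by exists v.
  apply: filterS (yU k%:R) => n kn /=; have [g0 _ gE] := gP n.
  by rewrite -[X in mdist X _]g0 gE ?lexx ?mdist_ge0 ?ler0n ?kn// sub0r normrN ger0_norm.
have {gU} [u uP] := choice gU; exists u => m n.
apply: (cvg_unique (@Rhausdorff R) (cvg_mdist (uP m) (uP n))).
apply: cvg_near_cst; near=> k.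
have [_ _ gE] := gP k; rewrite distrC gE ?ler0n//=; near: k; exact: yU.
Unshelve. all: by end_near. Qed.

(** * Horofunctions as ultrafilter limits *)

(** The expression stays between [- mdist x b] and [mdist x b], so along an ultrafilter it converges
    for every [x], without passing to subsequences. *)
Definition horolim (R : realType) (N : metricType R) (U : set_system nat)
    (b : N) (z : nat -> N) : {ptws N -> R} :=
  fun x => lim (mdist x (z n) - mdist b (z n) @[n --> U]).

Lemma mdistB_le (R : realType) (N : metricType R) (x y z : N) :
  mdist x z - mdist y z <= mdist x y.
Proof. by rewrite lerBlDr metric_triangle. Qed.

Lemma horolim_cvg (R : realType) (N : metricType R) (U : set_system nat)
    (b : N) (z : nat -> N) (x : N) : UltraFilter U ->
  mdist x (z n) - mdist b (z n) @[n --> U] --> horolim U b z x.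
Proof.
move=> FU; apply: (@ultra_bounded_cvg _ _ _ _ (- mdist x b) (mdist x b)).
near=> n; rewrite mdistB_le andbT.
by rewrite lerNl opprB (metric_sym x b) mdistB_le.
Unshelve. all: by end_near. Qed.

Arguments horolim_cvg {R N U} b z x _.

Lemma horolim_ge (R : realType) (N : metricType R) (U : set_system nat)
    (b : N) (z : nat -> N) (x : N) : UltraFilter U ->
  - mdist b x <= horolim U b z x.
Proof.
move=> FU; apply: limr_ge; first exact: horolim_cvg.
by near=> n; rewrite lerNl opprB mdistB_le.
Unshelve. all: by end_near. Qed.

Lemma horolim_lip (R : realType) (N : metricType R) (U : set_system nat)
    (b : N) (z : nat -> N) (x y : N) : UltraFilter U ->
  horolim U b z x <= mdist x y + horolim U b z y.
Proof.
move=> FU; have yz : mdist x y + (mdist y (z n) - mdist b (z n)) @[n --> U]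
    --> mdist x y + horolim U b z y.
  by apply: cvgD; [exact: cvg_cst|exact: horolim_cvg].
apply: (ler_cvg_to (horolim_cvg b z x FU) yz); near=> n.
by rewrite addrA lerD2r metric_triangle.
Unshelve. all: by end_near. Qed.

(** If the limit were [internal_functional b y], it would be smallest at [y]. But the points at
    distance 1 from [y] on geodesics towards [z n] converge along [U] to some [v], where the limit
    is lower than at [y] by at least 1. *)
Lemma horolim_horofunction (R : realType) (N : metricType R)
    (U : set_system nat) (b : N) (z : nat -> N) : UltraFilter U ->
  proper_metric N -> geodesic_metric N ->
  mdist b (z n) @[n --> U] --> +oo -> horofunctions b (horolim U b z).
Proof.
move=> FU Np Ng /cvgryPge zoo; split.
  rewrite /metric_compactification closureEcvg.
  exists ((fun n => internal_functional b (z n)) @ U).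
    exact: fmap_proper_filter.
  split.
    apply/pointwise_cvgP => x; exact: horolim_cvg.
  by move=> A rA; apply: nearW => n; apply: rA; exists (z n).
move=> [y _ hy].
have yz r : \forall n \near U, r <= mdist y (z n).
  apply: filterS (zoo (r + mdist b y)) => n.
  by have := metric_triangle b y (z n); lra.
have /choice[g gP] n := geodesic_from0 y (z n) Ng.
have [|v _ gv] := ultra_compact_cvg (f := fun n => g n 1) FU (Np y 1).
  apply: filterS (yz 1) => n yn /=; have [g0 _ gE] := gP n.
  by rewrite -[X in mdist X _]g0 gE ?lexx ?mdist_ge0 ?ler01 ?yn// sub0r normrN normr1.
have yv : mdist y v = 1.
  apply: (cvg_unique (@Rhausdorff R) (cvg_mdist (cvg_cst y) gv)).
  apply: cvg_near_cst; near=> n; have [g0 _ gE] := gP n.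
  rewrite -[X in mdist X _]g0 gE ?lexx ?mdist_ge0 ?ler01 ?sub0r ?normrN ?normr1//=.
  by near: n; exact: yz.
have gvz : mdist (g n 1) v - 1 @[n --> U] --> (0 : R) - 1.
  apply: cvgB; last exact: cvg_cst.
  by rewrite -(mdistxx v); apply: cvg_mdist => //; exact: cvg_cst.
have hvy : mdist v (z n) - mdist b (z n) - (mdist y (z n) - mdist b (z n))
    @[n --> U] --> horolim U b z v - horolim U b z y.
  by apply: cvgB; exact: horolim_cvg.
have : horolim U b z v - horolim U b z y <= 0 - 1.
  apply: (ler_cvg_to hvy gvz); near=> n.
  have [_ gz gE] := gP n.
  have : mdist (g n 1) (z n) = mdist y (z n) - 1.
    rewrite -[X in mdist _ X]gz gE ?lexx ?mdist_ge0 ?ler01//=; last by near: n; exact: yz.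
    by rewrite distrC ger0_norm// subr_ge0; near: n; exact: yz.
  have := metric_triangle v (g n 1) (z n); rewrite (metric_sym v (g n 1)); lra.
rewrite -hy /internal_functional mdistxx metric_sym yv; lra.
Unshelve. all: by end_near. Qed.


(** * Finiteness of the detour cost *)

(** Letting [m] tend to infinity in the almost geodesic inequality for [e = 1] bounds [h (w k)] by
    [1 - mdist (w k) (w 0) + mdist b (w 0)]. *)
Lemma almost_geodesic_bounded (R : realType) (N : metricType R) (b : N)
    (w : nat -> N) (h : {ptws N -> R}) :
  almost_geodesic w ->
  (forall x, mdist x (w n) - mdist b (w n) @[n --> \oo] --> h x) ->
  \forall n \near \oo, mdist b (w n) + h (w n) <= 1 + mdist b (w 0%N) *+ 2.
Proof.
move=> [_ /(_ 1 ltr01)[K wK]] wh; exists K => // k /= Kk.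
suff : h (w k) <= 1 - mdist (w k) (w 0%N) + mdist b (w 0%N).
  by have := metric_triangle b (w 0%N) (w k);
    rewrite (metric_sym (w 0%N)); lra.
apply: (ler_cvg_to (wh (w k)) (cvg_cst _)); exists k => // m /= km.
have := wK _ _ Kk km; have := metric_triangle (w m) b (w 0%N).
by rewrite (metric_sym (w m) (w k)) (metric_sym (w m) b); lra.
Qed.

Lemma limn_einf_lt_pinfty (R : realType) (u : nat -> R) (C : R) :
  (\forall n \near \oo, u n <= C) -> (limn_einf (fun n => (u n)%:E) < +oo)%E.
Proof.
move=> uC; apply: (@le_lt_trans _ _ C%:E); last exact: ltry.
rewrite limn_einf_lim; apply: lime_le; first exact: is_cvg_einfs.
near=> n; apply: (@le_trans _ _ (u n)%:E).
  by apply: ereal_inf_lbound; exists n => //=.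
by rewrite lee_fin; near: n.
Unshelve. all: by end_near. Qed.

(* As [h] is 1-Lipschitz, [h x - horolim U b z x] is at most
   [lim (mdist b (z n) + h (z n))] for every [x]; so the boundedness of
   [mdist b + h] passes from [z] to any almost geodesic converging to
   [horolim U b z]. *)
Lemma detour_cost_lt_pinfty (R : realType) (N : metricType R)
    (U : set_system nat) (b : N) (z : nat -> N) (h : {ptws N -> R}) (C : R) :
  UltraFilter U -> busemann_points b (horolim U b z) ->
  (forall x y, h x <= mdist x y + h y) ->
  (\forall n \near U, mdist b (z n) + h (z n) <= C) ->
  (detour_cost b (horolim U b z) h < +oo)%E.
Proof.
move=> FU [_ [w [wgeod wh]]] hlip zC.
have hC x : h x <= horolim U b z x + C.
  rewrite -lerBlDr; apply: limr_ge; first exact: horolim_cvg.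
  near=> n; have := hlip x (z n).
  have : mdist b (z n) + h (z n) <= C by near: n.
  by lra.
apply: le_lt_trans (limn_einf_lt_pinfty (u := fun n => mdist b (w n) + h (w n))
  (C := 1 + mdist b (w 0%N) *+ 2 + C) _).
  apply: ereal_inf_lbound; exists w => //=.
  by apply/pointwise_cvgP => x; exact: wh.
apply: filterS (almost_geodesic_bounded wgeod wh) => n.
by have := hC (w n); lra.
Unshelve. all: by end_near. Qed.

(** * Limit coordinates in a sup-product *)

Lemma sup_dist_ge (R : realType) (q : nat) (N : 'I_q -> metricType R)
    (x y : forall i, N i) (i : 'I_q) :
  mdist (x i) (y i) <= sup_dist x y.
Proof. by rewrite /sup_dist; exact: (le_bigmax _ (fun i => mdist (x i) (y i))). Qed.

Lemma sup_dist_attained (R : realType) (q : nat) (N : 'I_q -> metricType R)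
    (x y : forall i, N i) : (0 < q)%N ->
  exists i, sup_dist x y = mdist (x i) (y i).
Proof.
move=> q0; have [|i _ iE] := @eq_bigmax _ R 'I_q 0 (Ordinal q0) xpredT
  (fun i => mdist (x i) (y i)) isT; last by exists i.
by move=> i _; exact: mdist_ge0.
Qed.

(** This reduces the embedding to finite-dimensional data: infinite detour distances force equal
    horofunctions, so only the additive constants [a x i] tell the sequences apart. *)
Lemma sup_isometric_coordinates (R : realType) (q : nat)
    (N : 'I_q -> metricType R) (b : forall i, N i) (A : Type)
    (X : A -> nat -> forall i, N i) (c : A -> A -> R) (x0 : A) :
  (0 < q)%N ->
  (forall i, proper_metric (N i)) -> (forall i, geodesic_metric (N i)) ->
  (forall i, horofunctions (b i) `<=` busemann_points (b i)) ->
  (forall i (h h' : {ptws N i -> R}),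
     busemann_points (b i) h -> busemann_points (b i) h' ->
     h <> h' -> detour_dist (b i) h h' = +oo%E) ->
  (forall x, c x x = 0) ->
  (forall x y n m, (n < m)%N ->
     sup_dist (X x n) (X y m) = m%:R - n%:R + c x y) ->
  exists (J : {set 'I_q}) (a : A -> 'I_q -> R), forall x y,
    (forall i, i \in J -> a x i - a y i <= c x y) /\
    (exists2 i, i \in J & a x i - a y i = c x y).
Proof.
move=> q0 Np Ng Nb Nd cxx Xc.
have [U [FU ooU]] := ultraFilterLemma eventually_filter.
pose z x i n := X x n i.
pose e x i n : R := n%:R - mdist (b i) (z x i n).
pose a x i := lim (e x i n @[n --> U]).
(* An upper bound suffices for convergence, since [zle] bounds [e x i] from below. *)
pose J x i := exists B, \forall n \near U, e x i n <= B.
pose h x i := horolim U (b i) (z x i).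
have gtU k : \forall n \near U, (k < n)%N by apply: ooU; exact: nbhs_infty_gt.
have zX x y i n m : (n < m)%N ->
    mdist (z x i n) (z y i m) <= m%:R - n%:R + c x y.
  by move=> nm; rewrite -Xc//; exact: sup_dist_ge.
have zle x i n : (0 < n)%N ->
    mdist (b i) (z x i n) <= mdist (b i) (z x i 0%N) + n%:R.
  move=> n0; apply: le_trans (metric_triangle _ (z x i 0%N) _) _.
  by rewrite lerD2l; have := zX x x i _ _ n0; rewrite cxx; lra.
have ecvg x i : J x i -> e x i n @[n --> U] --> a x i.
  move=> [B eB]; apply: (@ultra_bounded_cvg _ _ _ _ (- mdist (b i) (z x i 0%N)) B).
  apply: filterS2 eB (gtU 0%N) => n -> /(zle x i); rewrite andbT /e; lra.
(* Subtract [mdist (b i) (z y i m)] from both sides of [zX] and let [m] run along [U]. *)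
have upper x y i n : J y i -> h y i (z x i n) <= a y i + (c x y - n%:R).
  move=> Jy; have ey : e y i m + (c x y - n%:R) @[m --> U] --> a y i + (c x y - n%:R).
    by apply: cvgD; [exact: ecvg|exact: cvg_cst].
  apply: (ler_cvg_to (horolim_cvg (b i) (z y i) (z x i n) FU) ey).
  by apply: filterS (gtU n) => m /(zX x y i); rewrite /e; lra.
(* As [h y i] is at least [- mdist (b i)], [upper] bounds [e x i n] uniformly in [n]; so boundedness
   passes from [y] to every [x]. *)
have a_le x y i : J y i -> J x i /\ a x i - a y i <= c x y.
  move=> Jy; have ele n : e x i n <= a y i + c x y.
    have := upper x y i n Jy; have := horolim_ge (b i) (z y i) (z x i n) FU.
    by rewrite -/(h y i) /e; lra.
  have Jx : J x i by exists (a y i + c x y); exact: nearW.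
  split=> //; rewrite lerBlDl; apply: limr_le; last exact: nearW.
  exact: ecvg.
have buse x i : J x i -> busemann_points (b i) (h x i).
  move=> [B eB]; apply: Nb; apply: horolim_horofunction => //.
  apply/cvgryPge => r; near=> n.
  have : e x i n <= B by near: n.
  have : r + B <= n%:R by near: n; apply: ooU; exact: nbhs_infty_ger.
  by rewrite /e; lra.
have det x y i : J x i -> J y i -> (detour_cost (b i) (h x i) (h y i) < +oo)%E.
  move=> Jx Jy; apply: (detour_cost_lt_pinfty
    (C := mdist (b i) (z x i 0%N) + a y i + c x y) FU (buse x i Jx)).
    by move=> u v; exact: horolim_lip.
  apply: filterS (gtU 0%N) => n /(zle x i) bz.
  by have := upper x y i n Jy; lra.
have hE x y i : J x i -> J y i -> h x i = h y i.
  move=> Jx Jy; apply: contrapT => /(Nd i _ _ (buse x i Jx) (buse y i Jy)).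
  have := lte_add_pinfty (det x y i Jx Jy) (det y x i Jy Jx).
  by rewrite /detour_dist => /[swap] ->; rewrite ltxx.
(* For each large [m] some coordinate attains the sup-distance; the ultrafilter selects one
   coordinate that does so for almost all [m]. *)
have attain x y : exists2 i, J y i & h y i (z x i 0%N) - a y i = c x y.
  have [|i iU] := @ultra_near_ex _ U 'I_q
      (fun i m => mdist (z x i 0%N) (z y i m) = m%:R + c x y) FU.
    apply: filterS (gtU 0%N) => m m0.
    have [i zE] := sup_dist_attained (X x 0%N) (X y m) q0.
    by exists i; rewrite -[LHS]zE Xc// subr0.
  have eE : \forall m \near U, mdist (z x i 0%N) (z y i m) -
      mdist (b i) (z y i m) - c x y = e y i m.
    by apply: filterS iU => m; rewrite /e; lra.
  have Jy : J y i.
    exists (mdist (z x i 0%N) (b i) - c x y); apply: filterS eE => m <-.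
    by rewrite lerD2r mdistB_le.
  exists i => //; apply/eqP; rewrite subr_eq addrC -subr_eq; apply/eqP.
  apply: (cvg_unique (@Rhausdorff R) _ (ecvg y i Jy)).
  have : mdist (z x i 0%N) (z y i m) - mdist (b i) (z y i m) - c x y
      @[m --> U] --> h y i (z x i 0%N) - c x y.
    by apply: cvgB; [exact: horolim_cvg|exact: cvg_cst].
  by apply: cvg_trans; exact: near_eq_cvg.
exists [set i | `[< J x0 i >]]%SET, a => x y; split=> [i|].
  by rewrite inE => /asboolP /(a_le y)[Jy _]; have [] := a_le x y i Jy.
have [i Jy hy] := attain x y; have [Jx axy] := a_le x y i Jy.
exists i; first by rewrite inE; apply/asboolP; have [] := a_le x0 y i Jy.
(* The missing inequality follows from [h x i = h y i] and from [upper] for [x] against itself at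
   time 0. *)
apply/eqP; rewrite eq_le axy/= -hy -(hE x y i Jx Jy).
by have := upper x x i 0%N Jx; rewrite cxx; lra.
Unshelve. all: by end_near. Qed.

(** * Counting points at pairwise sup-distance 1 *)

(** Each point is determined by the set of coordinates in [J] where it is maximal, and there are at
    most [2 ^ q] such sets. *)
Lemma card_sup_isometric_coordinates (R : realType) (q : nat) (A : finType)
    (J : {set 'I_q}) (a : A -> 'I_q -> R) (c : A -> A -> R) :
  (forall x y, c x y <= 1) ->
  (forall x y, x != y -> c x y = 1 \/ c y x = 1) ->
  (forall x y,
    (forall i, i \in J -> a x i - a y i <= c x y) /\
    (exists2 i, i \in J & a x i - a y i = c x y)) ->
  (#|A| <= 2 ^ q)%N.
Proof.
move=> c1 cneq ac.
(* In each coordinate the values of [a] span at most 1, so [a x i - a y i = 1]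
   forces [a x i] to be the maximum and [a y i] not to be. *)
pose S x := [set i in J | [forall y, a y i <= a x i]]%SET.
have S1 x y : c x y = 1 -> S x != S y.
  move=> cxy; have [_ [i iJ aE]] := ac x y.
  apply/eqP => /setP/(_ i); rewrite !inE iJ/=.
  have -> : [forall t, a t i <= a x i].
    by apply/forallP => t; have [/(_ i iJ) + _] := ac t y; have := c1 t y; lra.
  by move=> /esym/forallP/(_ x); lra.
have Sinj : injective S.
  move=> x y Sxy; apply/eqP; apply/negPn/negP => /cneq[] /S1.
    by rewrite Sxy eqxx.
  by rewrite Sxy eqxx.
apply: leq_trans (leq_card S Sinj) _.
by rewrite -[X in (X <= _)%N]cardsT -powersetT card_powerset cardsT card_ord.
Qed.

(** * Sequences indexed by the vertices of the cube *)

Unset Implicit Arguments.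
Set Strict Implicit.

Theorem theorem1p2 (R : realType) (p q : nat)
  (hp : (1 <= p)%N) (hq : (1 <= q)%N)
  (M : 'I_p -> metricType R) (N : 'I_q -> metricType R)
  (b : forall j : 'I_q, N j)
  (M_proper : forall j : 'I_p, proper_metric (M j))
  (M_geodesic : forall j : 'I_p, geodesic_metric (M j))
  (M_almost_geodesic : forall j : 'I_p,
     exists y : nat -> M j, almost_geodesic y)
  (N_proper : forall j : 'I_q, proper_metric (N j))
  (N_geodesic : forall j : 'I_q, geodesic_metric (N j))
  (N_busemann : forall j : 'I_q,
     horofunctions (b j) `<=` busemann_points (b j))
  (N_detour : forall (j : 'I_q) (h h' : {ptws N j -> R}),
     busemann_points (b j) h -> busemann_points (b j) h' ->
     h <> h' -> detour_dist (b j) h h' = +oo%E)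
  (hpq : (q < p)%N) :
  ~ exists f : (forall j : 'I_p, M j) -> (forall j : 'I_q, N j),
      isometric_embedding (@sup_dist R p M) (@sup_dist R q N) f.
Proof.
move=> [f fiso].
have /all_tag[u uP] :
    forall j, {u : nat -> M j | forall m n, mdist (u m) (u n) = `|n%:R - m%:R| }.
  move=> j; apply: cid; have [y [yoo _]] := M_almost_geodesic j.
  exact: proper_geodesic_ray (M_proper j) (M_geodesic j) yoo.
pose X (x : {ffun 'I_p -> bool}) n := f (fun j => u j (n + x j)%N).
(* The default [-1] is below every difference of two bits, so it does not alter the maximum, [p]
   being positive. *)
pose c (x x' : {ffun 'I_p -> bool}) : R :=
  \big[Num.max/-1]_j ((x' j)%:R - (x j)%:R).
have c_ge (x x' : {ffun 'I_p -> bool}) j : (x' j)%:R - (x j)%:R <= c x x'.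
  exact: (le_bigmax _ (fun j => (x' j)%:R - (x j)%:R : R)).
have c1 x x' : c x x' <= 1.
  apply: bigmax_le => [|j _]; first lra.
  by case: (x j) (x' j) => [] []/=; lra.
have cxx x : c x x = 0.
  apply/eqP; rewrite eq_le; apply/andP; split.
    by apply: bigmax_le => [|j _]; [lra|rewrite subrr].
  by rewrite -(subrr (x (Ordinal hp))%:R); exact: c_ge.
(* Since [m - n] is at least 1, it absorbs a bit difference of [-1]: the absolute values open
   without change of sign, and the default 0 of [sup_dist] does no harm. *)
have Xc x x' n m : (n < m)%N -> sup_dist (X x n) (X x' m) = m%:R - n%:R + c x x'.
  move=> nm; have nm1 : n%:R + 1 <= m%:R :> R by rewrite natr1 ler_nat.
  have dE j : mdist (u j (n + x j)%N) (u j (m + x' j)%N) =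
      m%:R - n%:R + ((x' j)%:R - (x j)%:R).
    rewrite uP !natrD ger0_norm; first lra.
    by case: (x j) (x' j) => [] []/=; lra.
  have dle j : m%:R - n%:R + ((x' j)%:R - (x j)%:R) <= sup_dist (X x n) (X x' m).
    by rewrite /X fiso -dE; exact: (sup_dist_ge _ _ j).
  apply/eqP; rewrite eq_le; apply/andP; split.
    rewrite fiso; apply: bigmax_le => [|j _].
      by have : -1 <= c x x' by [exact: bigmax_ge_id]; lra.
    by rewrite dE lerD2l.
  rewrite -lerBrDl; apply: bigmax_le => [|j _].
    have := dle (Ordinal hp).
    by case: (x _) (x' _) => [] []/=; lra.
  by have := dle j; lra.
(* The zero vertex only serves to name [J]; every vertex gives the same set. *)
have [J [a ac]] := sup_isometric_coordinates [ffun=> false] hq N_proper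
  N_geodesic N_busemann N_detour cxx Xc.
have cneq x x' : x != x' -> c x x' = 1 \/ c x' x = 1.
  move=> xx'; have [j xj] : exists j, x j != x' j.
    apply: contrapT => /forallNP xE; move/eqP: xx'; apply.
    by apply/ffunP => j; apply/eqP/negPn/negP; exact: xE.
  have := c_ge x x' j; have := c_ge x' x j; have := c1 x x'; have := c1 x' x.
  by case: (x j) (x' j) xj => [] []//= _; [right|left]; lra.
have := card_sup_isometric_coordinates c1 cneq ac.
by rewrite card_ffun card_bool card_ord leq_exp2l// leqNgt hpq.
Qed.
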